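(* The set function $d_\infty$ (asymptotic dimension of metric spaces) is a dimension, namely it satisfies: (i) if $X\subset Y$ then $d_\infty(X)\le d_\infty(Y)$; (ii) if $X_1,X_2\subset X$ then $d_\infty(X_1\cup X_2)=\max\{d_\infty(X_1),d_\infty(X_2)\}$; (iii) if $X$ and $Y$ are metric spaces, then $d_\infty(X\times Y)\le d_\infty(X)+d_\infty(Y)$.
   Context: For a metric space $(X,\delta)$, $B_X(x,R)$ is the open ball of centre $x$ and radius $R$, and for $\Omega\subset X$, $n_r(\Omega)$ is the least number of open balls of radius $r$ of $X$ which cover $\Omega$ (possibly $\infty$). The asymptotic dimension of $X$ is $$d_\infty(X):=\lim_{r\to\infty}\limsup_{R\to\infty}\frac{\log n_r(B_X(x,R))}{\log R}\in[0,\infty],$$ which does not depend on the choice of $x\in X$. Metric spaces are non-empty. Subsets of a metric space are regarded as metric subspaces (with the restricted metric). The product $X\times Y$ carries any metric bi-Lipschitz equivalent to $\delta_{X\times Y}((x_1,y_1),(x_2,y_2))=\max\{\delta_X(x_1,x_2),\delta_Y(y_1,y_2)\}$. *)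

(* Defs.v *)
(* Metric spaces are [metricType]s; a subset [A] of one is regarded as a space
   through its type of elements [set_type A], written [A] by coercion. *)
From HB Require Import structures.
From mathcomp Require Import all_boot all_order all_algebra.
From mathcomp Require Import all_classical all_reals all_analysis.
From mathcomp Require Import lra.

Set Implicit Arguments.
Unset Strict Implicit.
Unset Printing Implicit Defensive.

Import Order.TTheory GRing.Theory Num.Theory.
Import numFieldNormedType.Exports.

Local Open Scope classical_set_scope.
Local Open Scope ring_scope.

(* [subtype_topology] already gives [set_type A] the induced pseudometric; only
   the distance is missing. *)
Section metric_subspace.
Context {R : realType} {X : metricType R} (A : set X).

Definition sub_mdist (x y : A) : R := mdist (set_val x) (set_val y).

Let sub_mdist_ge0 x y : 0 <= sub_mdist x y.
Proof. exact: mdist_ge0. Qed.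

Let sub_mdist_positivity x y : sub_mdist x y = 0 -> x = y.
Proof. by move=> /mdist_positivity/val_inj. Qed.

Let sub_ballEmdist (x : A) d : ball x d = [set y | sub_mdist x y < d].
Proof.
have -> : ball x d = set_val @^-1` ball (set_val x) d by [].
by rewrite ballEmdist.
Qed.

HB.instance Definition _ := @PseudoMetric_isMetric.Build R (set_type A)
  sub_mdist sub_mdist_ge0 sub_mdist_positivity sub_ballEmdist.

End metric_subspace.

Section metric_product.
Context {R : realType} (X Y : metricType R).

Definition max_mdist (p q : X * Y) : R :=
  Num.max (mdist p.1 q.1) (mdist p.2 q.2).

Definition bilipschitz_equiv (T : Type) (d e : T -> T -> R) : Prop :=
  exists2 L : R, 0 < L & forall p q, L^-1 * e p q <= d p q <= L * e p q.

Record prod_metric := ProdMetric {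
  pdist :> X * Y -> X * Y -> R ;
  pdistxx : forall p, pdist p p = 0 ;
  pdist_positivity : forall p q, pdist p q = 0 -> p = q ;
  pdist_sym : forall p q, pdist p q = pdist q p ;
  pdist_triangle : forall q p s, pdist p s <= pdist p q + pdist q s ;
  pdist_bilipschitz : bilipschitz_equiv pdist max_mdist }.

Definition prod_space (d : prod_metric) : Type := (X * Y)%type.

HB.instance Definition _ (d : prod_metric) := Choice.on (prod_space d).
HB.instance Definition _ (d : prod_metric) :=
  @isMetric.Build R (prod_space d) d (pdistxx d) (@pdist_positivity d)
    (pdist_sym d) (pdist_triangle d).

Lemma mdist_prodE (d : prod_metric) (p q : prod_space d) :
  mdist p q = d p q.
Proof. by []. Qed.

Let max_mdistxx p : max_mdist p p = 0.
Proof. by rewrite /max_mdist !mdistxx maxxx. Qed.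

Let max_mdist_positivity p q : max_mdist p q = 0 -> p = q.
Proof.
case: p q => [x y] [x' y'] h; congr pair; apply: mdist_positivity;
  apply/eqP; rewrite eq_le mdist_ge0 andbT -h le_max lexx ?orbT//.
Qed.

Let max_mdist_sym p q : max_mdist p q = max_mdist q p.
Proof. by rewrite /max_mdist metric_sym (metric_sym p.2). Qed.

Let max_mdist_triangle q p s :
  max_mdist p s <= max_mdist p q + max_mdist q s.
Proof.
rewrite ge_max; apply/andP; split.
  by rewrite (le_trans (metric_triangle _ q.1 _))// lerD// le_max lexx.
by rewrite (le_trans (metric_triangle _ q.2 _))// lerD// le_max lexx orbT.
Qed.

Let max_mdist_bilipschitz : bilipschitz_equiv max_mdist max_mdist.
Proof. by exists 1 => // p q; rewrite invr1 !mul1r lexx. Qed.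

Definition max_metric : prod_metric := ProdMetric max_mdistxx
  max_mdist_positivity max_mdist_sym max_mdist_triangle max_mdist_bilipschitz.

End metric_product.

Section asymptotic_dimension.
Context {R : realType}.
Local Open Scope ereal_scope.

(* [ereal_inf set0 = +oo]: no finite cover. *)
Definition covering_number (X : metricType R) (r : R) (W : set X) : \bar R :=
  ereal_inf [set (n%:R%:E) | n in
    [set n : nat | exists c : 'I_n -> X, W `<=` \bigcup_i ball (c i) r]].

(* [lne +oo = +oo]; in the upper limit only [1 < s] matters, for which
   [ln s > 0]. *)
Definition covering_exponent (X : metricType R) (x : X) (r : R) : \bar R :=
  limf_esup (fun s : R => lne (covering_number r (ball x s)) / (ln s)%:E)
    +oo%R.

Definition asdim_at (X : metricType R) (x : X) : \bar R :=
  lim (covering_exponent x r @[r --> +oo%R]).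

(* The choice of base point does not matter, see [asdimE]. The value on an
   empty type is irrelevant: spaces are non-empty. *)
Definition asdim (X : metricType R) : \bar R :=
  if pselect (inhabited X) is left X0 then asdim_at (inhabited_witness X0)
  else -oo.

Implicit Types (X : metricType R).

Lemma limf_esup_near_le (f g : R -> \bar R) :
  (\forall s \near +oo%R, f s <= g s) ->
  limf_esup f +oo%R <= limf_esup g +oo%R.
Proof.
move=> fg; apply: le_ereal_inf_tmp => _ [V FV <-].
apply: (@le_trans _ _ (ereal_sup (f @` (V `&` [set s | f s <= g s])))).
  apply: ereal_inf_lbound.
  by exists (V `&` [set s | f s <= g s]) => //; exact: filterI.
apply: ge_ereal_sup => _ [s [Vs fgs] <-].
by apply: (le_trans fgs); apply: ereal_sup_ubound; exists s.
Qed.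

Lemma limf_esup_near_le_cst (f : R -> \bar R) (c : \bar R) :
  (\forall s \near +oo%R, f s <= c) -> limf_esup f +oo%R <= c.
Proof.
move=> fc; apply: (@le_trans _ _ (ereal_sup (f @` [set s | f s <= c]))).
  by apply: ereal_inf_lbound; exists [set s | f s <= c].
by apply: ge_ereal_sup => _ [s sc <-].
Qed.

Lemma limf_esup_lt_near (f : R -> \bar R) (c : \bar R) :
  limf_esup f +oo%R < c -> \forall s \near +oo%R, f s < c.
Proof.
move=> /ereal_inf_lt[_ [V FV <-] Vc]; apply: filterS FV => s Vs.
by apply: le_lt_trans Vc; apply: ereal_sup_ubound; exists s.
Qed.

Lemma covering_number_ge0 X r (W : set X) : 0 <= covering_number r W.
Proof. by apply: le_ereal_inf_tmp => _ [n _ <-]; rewrite lee_fin. Qed.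

Lemma le_covering_number X (r r' : R) (W W' : set X) : (r' <= r)%R ->
  W `<=` W' -> covering_number r W <= covering_number r' W'.
Proof.
move=> rr WW; apply: ereal_inf_le_tmp => _ [n [c cW] <-]; exists n => //.
by exists c => w /WW/cW[i _ ci]; exists i => //; exact: le_ball ci.
Qed.

Lemma covering_number_ge1 X r (W : set X) : W !=set0 ->
  1 <= covering_number r W.
Proof.
move=> [w Ww]; apply: le_ereal_inf_tmp => _ [n [c cW] <-].
by case: n c cW => [c /(_ _ Ww)[[]]//|n c _]; rewrite lee_fin ler1n.
Qed.

Lemma lee_lne_covering X (r r' : R) (W W' : set X) : (r' <= r)%R ->
  W `<=` W' -> lne (covering_number r W) <= lne (covering_number r' W').
Proof.
move=> rr WW; rewrite lee_lne ?in_itv/= ?leey ?andbT ?covering_number_ge0//.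
exact: le_covering_number.
Qed.

Lemma lne_covering_ge0 X (r : R) (x : X) s : (0 < s)%R ->
  0 <= lne (covering_number r (ball x s)).
Proof.
by move=> s0; rewrite lne_ge0 covering_number_ge1//; exists x; exact: ballxx.
Qed.

Lemma lee_div_ln (a b : \bar R) (s : R) : (1 < s)%R -> a <= b ->
  a / (ln s)%:E <= b / (ln s)%:E.
Proof.
move=> s1 ab; have ls : (0 < ln s)%R by rewrite ln_gt0.
by rewrite inver gt_eqF// lee_wpmul2r// lee_fin invr_ge0 ltW.
Qed.

Lemma nonincreasing_covering_exponent X (x : X) :
  {homo covering_exponent x : r r' / (r <= r')%R >-> r' <= r}.
Proof.
move=> r r' rr; apply: limf_esup_near_le; near=> s.
apply: lee_div_ln; last exact: lee_lne_covering.
by near: s; apply: nbhs_pinfty_gt; rewrite num_real.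
Unshelve. all: by end_near. Qed.

Lemma cvg_covering_exponent X (x : X) :
  cvg (covering_exponent x r @[r --> +oo%R]).
Proof.
by apply/cvg_ex; eexists; apply: nonincreasing_cvge;
  exact: nonincreasing_covering_exponent.
Qed.

Lemma covering_exponent_ge0 X (x : X) r : 0 <= covering_exponent x r.
Proof.
apply: le_ereal_inf_tmp => _ [V FV <-].
have [s [Vs s1]] : exists s, V s /\ (1 < s)%R.
  apply: (@filter_ex _ +oo%R); apply: filterI => //.
  by apply: nbhs_pinfty_gt; rewrite num_real.
apply: (@le_trans _ _ (lne (covering_number r (ball x s)) / (ln s)%:E)).
  have s0 : (0 < s)%R by exact: lt_trans s1.
  have ls : (0 < ln s)%R by rewrite ln_gt0.
  rewrite inver gt_eqF// mule_ge0// ?lne_covering_ge0// lee_fin.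
  by rewrite invr_ge0 ltW.
by apply: ereal_sup_ubound; exists s.
Qed.

Lemma covering_exponent_le X (x y : X) r :
  covering_exponent x r <= covering_exponent y r.
Proof.
have := covering_exponent_ge0 y r.
move E : (covering_exponent y r) => [l||//] l0; last by rewrite leey.
rewrite lee_fin in l0.
apply/lee_addgt0Pr => e e0; apply: limf_esup_near_le_cst.
set c := (l + e / 2)%R.
have c0 : (0 < c)%R by rewrite /c ltr_wpDl// divr_gt0.
have /limf_esup_lt_near yc : covering_exponent y r < c%:E.
  by rewrite E lte_fin /c ltrDl divr_gt0.
pose D := mdist x y.
have D0 : (0 <= D)%R by exact: mdist_ge0.
case: yc => M [_ yc].
near=> s.
have s1 : (1 < s)%R by near: s; apply: nbhs_pinfty_gt; rewrite num_real.
have Ds : (D <= s)%R by near: s; apply: nbhs_pinfty_ge; exact: num_real.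
have Ms : (M < s)%R by near: s; apply: nbhs_pinfty_gt; rewrite num_real.
have s0 : (0 < s)%R by exact: lt_trans s1.
have sD1 : (1 < s + D)%R by rewrite (lt_le_trans s1)// lerDl.
have ls : (0 < ln s)%R by rewrite ln_gt0.
have lsD : (0 < ln (s + D))%R by rewrite ln_gt0.
have : lne (covering_number r (ball y (s + D))) / (ln (s + D))%:E < c%:E.
  by apply: yc; rewrite (lt_le_trans Ms)// lerDl.
rewrite inver gt_eqF// lte_pdivrMr// => /ltW h.
rewrite inver gt_eqF// lee_pdivrMr//.
have xy : ball x s `<=` ball y (s + D).
  rewrite !ballEmdist => z/= xz; rewrite (le_lt_trans (metric_triangle _ x _))//.
  by rewrite addrC (metric_sym y) ltrD2r.
apply: (le_trans (lee_lne_covering (lexx r) xy)); apply: (le_trans h).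
rewrite -EFinD -EFinM lee_fin.
have l2s : (ln (s + D) <= ln 2 + ln s)%R.
  rewrite -lnM ?posrE// ler_ln ?posrE ?mulr_gt0//; last by lra.
  by lra.
have : (ln s >= c * ln 2 / (e / 2))%R.
  by rewrite -[X in (X <= _)%R]expRK ler_ln ?posrE ?expR_gt0//.
rewrite ler_pdivrMr ?divr_gt0// => h2.
rewrite (le_trans (ler_wpM2l (ltW c0) l2s))// mulrDr.
rewrite /c in h2 *; nra.
Unshelve. all: by end_near. Qed.

Lemma asdim_at_le X (x y : X) : asdim_at x <= asdim_at y.
Proof.
apply: lee_lim; [exact: cvg_covering_exponent..|].
by apply: nearW => r; exact: covering_exponent_le.
Qed.

Lemma asdimE X (x : X) : asdim X = asdim_at x.
Proof.
rewrite /asdim; case: pselect => [X0|]; last by case; exists.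
by apply/eqP; rewrite eq_le !asdim_at_le.
Qed.

End asymptotic_dimension.

(* Main.v *)
(* [d_infty X <= c] holds exactly when, for every [c' > c], there is a radius [r]
   such that the balls [B(x, s)] are covered by [O(s ^ c')] balls of radius [r].
   Such bounds are pulled back along bi-Lipschitz embeddings (the radius gets
   multiplied by [2 L], as the centres have to be moved into the image), add up
   on unions and are multiplied on products, where the exponents add up. *)
Require Import Defs.
From mathcomp Require Import all_boot all_order all_algebra.
From mathcomp Require Import all_classical all_reals all_analysis.
From mathcomp Require Import lra.

Set Implicit Arguments.
Unset Strict Implicit.
Unset Printing Implicit Defensive.

Import Order.TTheory GRing.Theory Num.Theory.
Import numFieldNormedType.Exports.

Local Open Scope classical_set_scope.
Local Open Scope ring_scope.

(** * Finite covers by balls of a fixed radius *)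

Section covered.
Context {R : realType}.
Implicit Types (X Y : metricType R) (r t : R).

(** A list of centres with a real bound on its length replaces the infimum: such covers can be
    mapped, concatenated and multiplied directly. *)
Definition covered X r (W : set X) t :=
  exists2 l : seq X, (size l)%:R <= t &
    forall w, W w -> exists2 a, a \in l & mdist a w < r.

Lemma covered_le X r r' t t' (W W' : set X) :
  r <= r' -> t <= t' -> W' `<=` W -> covered r W t -> covered r' W' t'.
Proof.
move=> rr tt WW [l lt lW]; exists l; first exact: le_trans tt.
by move=> w /WW/lW[a al aw]; exists a => //; exact: lt_le_trans rr.
Qed.

Lemma covered_preimage X Y (f : X -> Y) (L : R) (x0 : X) r t (W : set Y) :
  0 < L -> (forall x x', mdist x x' <= L * mdist (f x) (f x')) ->
  covered r W t -> covered (L * (r + r)) (f @^-1` W) t.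
Proof.
move=> L0 fL [l lt lW].
(* A centre [a] whose ball meets the range of [f] is replaced by a point [g a] that [f] sends into
   this ball. The default [x0] serves the other centres, whose balls contain no point of the
   range. *)
have /choice[g gP] : forall a, exists x, forall z, mdist a (f z) < r ->
    mdist a (f x) < r.
  move=> a; have [[x ax]|h] := pselect (exists x, mdist a (f x) < r).
    by exists x.
  by exists x0 => z az; exfalso; apply: h; exists z.
exists (map g l); first by rewrite size_map.
move=> w /lW[a al aw]; exists (g a); first exact: map_f.
rewrite (le_lt_trans (fL _ _))// ltr_pM2l//.
rewrite (le_lt_trans (metric_triangle _ a _))// ltrD// metric_sym.
exact: gP aw.
Qed.

Lemma covered_image X Y (f : X -> Y) r t (W : set X) :
  (forall x x', mdist (f x) (f x') = mdist x x') ->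
  covered r W t -> covered r (f @` W) t.
Proof.
move=> fE [l lt lW]; exists (map f l); first by rewrite size_map.
by move=> _ [w /lW[a al aw] <-]; exists (f a); [exact: map_f|rewrite fE].
Qed.

Lemma covered_setU X r t t' (W W' : set X) :
  covered r W t -> covered r W' t' -> covered r (W `|` W') (t + t').
Proof.
move=> [l lt lW] [l' lt' lW']; exists (l ++ l').
  by rewrite size_cat natrD lerD.
by move=> w [/lW|/lW'] [a al aw]; exists a; rewrite // mem_cat al ?orbT.
Qed.

(** In the max metric a product of two balls of equal radius is a ball of that radius, so the pairs
    of centres suffice. *)
Lemma covered_prod X Y r t t' (W : set X) (V : set Y) :
  covered r W t -> covered r V t' ->
  covered r (W `*` V : set (prod_space (max_metric X Y))) (t * t').
Proof.
move=> [l lt lW] [l' lt' lV].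
exists [seq ((a, b) : prod_space (max_metric X Y)) | a <- l, b <- l'].
  by rewrite size_allpairs natrM ler_pM.
move=> [w v] [/= /lW[a al aw] /lV[b bl bv]]; exists (a, b).
  by apply/allpairsP; exists (a, b).
by rewrite mdist_prodE /= /max_mdist/= gt_max aw bv.
Qed.

(** An infimum strictly below [t] has a member below [t], that is, an actual finite cover; this
    excludes the value [+oo]. *)
Lemma covering_number_lt_covered X r (W : set X) t :
  (covering_number r W < t%:E)%E -> covered r W t.
Proof.
move=> /ereal_inf_lt[_ [n [c cW] <-]]; rewrite lte_fin => nt.
exists (map c (enum 'I_n)); first by rewrite size_map size_enum_ord ltW.
move=> w /cW[i _]; rewrite ballEmdist /= => ciw; exists (c i) => //.
by rewrite map_f// mem_enum.
Qed.

Lemma covered_covering_number_le X r (W : set X) t :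
  covered r W t -> (covering_number r W <= t%:E)%E.
Proof.
move=> [l lt lW]; apply: (@le_trans _ _ (size l)%:R%:E); last by rewrite lee_fin.
apply: ereal_inf_lbound; exists (size l) => //.
exists (tnth (in_tuple l)) => w /lW[a]; rewrite -[l]/(tval (in_tuple l)).
by move=> /tnthP[i ->] aw; exists i => //; rewrite ballEmdist.
Qed.

End covered.

(** * Polynomial covering bounds and the asymptotic dimension *)

Section growth.
Context {R : realType}.
Implicit Types (X Y Z : metricType R).

(** One radius serves all large [s]; the factor [K] absorbs the constants that come from rescaling
    [s]. *)
Definition growth X (x : X) (c : R) := exists r K : R, 0 < K /\
  \forall s \near +oo, covered r (ball x s) (K * s `^ c).

(** The exponent is nonincreasing in the radius, so its limit is its infimum and a single radius
    suffices for an upper bound. *)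
Lemma asdim_inf X (x : X) :
  asdim X = ereal_inf (range (covering_exponent x)).
Proof.
rewrite (asdimE x) /asdim_at; apply: cvg_lim; first exact: ereal_hausdorff.
by apply: nonincreasing_cvge; exact: nonincreasing_covering_exponent.
Qed.

Lemma asdim_ge0 X (x : X) : (0 <= asdim X)%E.
Proof.
rewrite (asdim_inf x); apply: le_ereal_inf_tmp => _ [r _ <-].
exact: covering_exponent_ge0.
Qed.

(** Some radius has its upper limit below [c]; exponentiating log n < c log s then gives the bound
    with [K] equal to 1. *)
Lemma asdim_lt_growth X (x : X) (c : R) : (asdim X < c%:E)%E -> growth x c.
Proof.
rewrite (asdim_inf x) => /ereal_inf_lt[_ [r _ <-] /limf_esup_lt_near rc].
exists r, 1; split => //; near=> s.
have s1 : 1 < s by near: s; apply: nbhs_pinfty_gt; rewrite num_real.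
have s0 : 0 < s by exact: lt_trans s1.
have ls : 0 < ln s by rewrite ln_gt0.
have : (lne (covering_number r (ball x s)) / (ln s)%:E < c%:E)%E by near: s.
rewrite inver gt_eqF// lte_pdivrMr// -EFinM => h.
apply: covering_number_lt_covered; rewrite mul1r.
have sc0 : 0 < s `^ c by exact: powR_gt0.
by rewrite -lte_lne ?lne_EFin// ?ln_powR// in_itv/= leey ?covering_number_ge0//
  lee_fin ltW.
Unshelve. all: by end_near. Qed.

(** The logarithm of K s^c divided by log s is c + log K / log s, whose last term tends to 0. *)
Lemma growth_asdim_le X (x : X) (c : R) : growth x c -> (asdim X <= c%:E)%E.
Proof.
move=> [r [K [K0 xc]]]; rewrite (asdim_inf x).
apply: (@le_trans _ _ (covering_exponent x r)).
  by apply: ereal_inf_lbound; exists r.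
apply/lee_addgt0Pr => e e0; apply: limf_esup_near_le_cst; near=> s.
have s1 : 1 < s by near: s; apply: nbhs_pinfty_gt; rewrite num_real.
have s0 : 0 < s by exact: lt_trans s1.
have ls : 0 < ln s by rewrite ln_gt0.
have : covered r (ball x s) (K * s `^ c) by near: s.
move=> /covered_covering_number_le h.
rewrite inver gt_eqF// lee_pdivrMr// -EFinD -EFinM.
have Ks0 : 0 < K * s `^ c by rewrite mulr_gt0// powR_gt0.
apply: (@le_trans _ _ (lne (K * s `^ c)%:E)).
  by rewrite lee_lne ?in_itv/= ?leey ?andbT ?covering_number_ge0// lee_fin ltW.
rewrite lne_EFin// lnM ?posrE// ?powR_gt0// ln_powR lee_fin mulrDl addrC lerD2l.
(* What remains is ln K <= e ln s, true once s >= exp (ln K / e). *)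
by rewrite mulrC -ler_pdivrMr// -[leLHS]expRK ler_ln ?posrE ?expR_gt0//.
Unshelve. all: by end_near. Qed.

(** The map sends [ball x s] into [ball (f x) (L * s)], whose covers pull back; evaluating the bound
    at [L * s] costs the factor L^c. *)
Lemma growth_preimage X Y (f : X -> Y) (L : R) (x : X) (c : R) : 0 < L ->
  (forall x x', mdist x x' <= L * mdist (f x) (f x') /\
                mdist (f x) (f x') <= L * mdist x x') ->
  growth (f x) c -> growth x c.
Proof.
move=> L0 fL [r [K [K0 [M [_ xc]]]]].
exists (L * (r + r)), (K * L `^ c); split; first by rewrite mulr_gt0// powR_gt0.
near=> s.
have s0 : 0 < s by near: s; apply: nbhs_pinfty_gt; rewrite num_real.
have Ms : M < L * s.
  rewrite mulrC -ltr_pdivrMr//.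
  by near: s; apply: nbhs_pinfty_gt; rewrite num_real.
have := covered_preimage x L0 (fun x x' => (fL x x').1) (xc _ Ms).
apply: covered_le => //; first by rewrite powRM ?(ltW L0) ?(ltW s0)// mulrA.
move=> z; rewrite !ballEmdist /= => xz.
by rewrite (le_lt_trans (fL _ _).2)// ltr_pM2l.
Unshelve. all: by end_near. Qed.

(** Reduces inequalities between dimensions to real exponents, which is what [growth] takes. *)
Lemma lee_lt_fin (a b : \bar R) :
  (forall c : R, b < c%:E -> a <= c%:E)%E -> (a <= b)%E.
Proof.
move=> h; case: b h => [b||] h; last 2 first.
- by rewrite leey.
(* For [b] equal to [-oo], taking [c] to be 0 excludes [+oo], and [a - 1] excludes a real [a]. *)
- case: a h => [a||//] h; last by have := h 0 (ltNyr 0).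
  by have := h (a - 1) (ltNyr _); rewrite lee_fin lerBrDr gerDl ler10.
by apply/lee_addgt0Pr => e e0; apply: h; rewrite lte_fin ltrDl.
Qed.

Lemma asdim_le_embedding X Y (f : X -> Y) (L : R) : inhabited X -> 0 < L ->
  (forall x x', mdist x x' <= L * mdist (f x) (f x') /\
                mdist (f x) (f x') <= L * mdist x x') ->
  (asdim X <= asdim Y)%E.
Proof.
move=> [x] L0 fL; apply: lee_lt_fin => c /(asdim_lt_growth (f x)) yc.
exact: growth_asdim_le (growth_preimage L0 fL yc).
Qed.

Lemma asdim_le_isometry X Y (f : X -> Y) : inhabited X ->
  (forall x x', mdist (f x) (f x') = mdist x x') -> (asdim X <= asdim Y)%E.
Proof.
move=> X0 fE; apply: (asdim_le_embedding (f := f) X0 ltr01) => x x'.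
by rewrite fE !mul1r.
Qed.

(** The upper bound for unions, with isometric copies in place of subsets. *)
Lemma asdim_le_maxe X Y Z (f : X -> Z) (g : Y -> Z) :
  inhabited X -> inhabited Y ->
  (forall x x', mdist (f x) (f x') = mdist x x') ->
  (forall y y', mdist (g y) (g y') = mdist y y') ->
  (forall z, range f z \/ range g z) ->
  (asdim Z <= maxe (asdim X) (asdim Y))%E.
Proof.
move=> [x] [y] fE gE fg; apply: lee_lt_fin => c; rewrite gt_max => /andP[].
move=> /(asdim_lt_growth x)[r [K [K0 xc]]].
move=> /(asdim_lt_growth y)[r' [K' [K'0 [M [_ yc]]]]].
apply: (@growth_asdim_le _ (f x)).
(* Once [s] is at least the distance between [f x] and [g y], the ball of radius [s] about [f x]
   lies in the ball of radius [2 * s] about [g y]; hence the factor 2^c for the copy of [Y]. *)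
exists (Num.max r r'), (K + K' * 2 `^ c); split.
  by rewrite addr_gt0// mulr_gt0// powR_gt0.
near=> s.
have s0 : 0 < s by near: s; apply: nbhs_pinfty_gt; rewrite num_real.
have Ms : M < 2 * s.
  have : M < s by near: s; apply: nbhs_pinfty_gt; rewrite num_real.
  by lra.
have Ds : mdist (g y) (f x) <= s.
  by near: s; apply: nbhs_pinfty_ge; rewrite num_real.
have xs : covered r (ball x s) (K * s `^ c) by near: s.
have /= ys := yc _ Ms.
have := covered_setU (covered_le _ (lexx _) (@subset_refl _ _) (covered_image fE xs))
  (covered_le _ (lexx _) (@subset_refl _ _) (covered_image gE ys)).
move=> /(_ (Num.max r r')); rewrite !le_max !lexx orbT => /(_ isT isT).
apply: covered_le => //.
  by rewrite powRM ?(ltW s0)// mulrDl mulrA.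
rewrite !ballEmdist => z /=; case: (fg z) => -[w _ <-] xz; [left|right].
  by exists w => //=; rewrite -fE.
exists w => //=; rewrite -gE (le_lt_trans (metric_triangle _ (f x) _))//.
by rewrite mulr_natl mulr2n ler_ltD.
Unshelve. all: by end_near. Qed.

Lemma asdim_max_metric_le X Y : inhabited X -> inhabited Y ->
  (asdim (prod_space (max_metric X Y)) <= asdim X + asdim Y)%E.
Proof.
move=> [x] [y]; have := asdim_ge0 x; have := asdim_ge0 y.
(* An infinite dimension makes the bound trivial: nonnegativity of the other one prevents
   [-oo + +oo], which would be [-oo]. *)
move EY : (asdim Y) => [b||//]; last first.
  by move=> _ X0; rewrite addey ?leey// gt_eqF// (lt_le_trans _ X0)// ltNy0.
move EX : (asdim X) => [a||//] _ _; last by rewrite addye ?leey.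
apply/lee_addgt0Pr => e e0.
(* Exponents add on products, so the excess [e] is split evenly. *)
have /(asdim_lt_growth x)[r [K [K0 xc]]] : (asdim X < (a + e / 2)%:E)%E.
  by rewrite EX lte_fin ltrDl divr_gt0.
have /(asdim_lt_growth y)[r' [K' [K'0 yc]]] : (asdim Y < (b + e / 2)%:E)%E.
  by rewrite EY lte_fin ltrDl divr_gt0.
rewrite -!EFinD.
apply: (@growth_asdim_le _ ((x, y) : prod_space (max_metric X Y))).
exists (Num.max r r'), (K * K'); split; first by rewrite mulr_gt0.
near=> s.
have s0 : 0 < s by near: s; apply: nbhs_pinfty_gt; rewrite num_real.
have xs : covered r (ball x s) (K * s `^ (a + e / 2)) by near: s.
have ys : covered r' (ball y s) (K' * s `^ (b + e / 2)) by near: s.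
have := covered_prod (covered_le _ (lexx _) (@subset_refl _ _) xs)
  (covered_le _ (lexx _) (@subset_refl _ _) ys).
move=> /(_ (Num.max r r')); rewrite !le_max !lexx orbT => /(_ isT isT).
apply: covered_le => //.
  rewrite mulrACA -powRD; last by rewrite (gt_eqF s0) implybT.
  by rewrite (_ : a + e / 2 + (b + e / 2) = a + b + e)//; lra.
rewrite !ballEmdist => -[w v] /=.
by rewrite mdist_prodE /= /max_mdist /= gt_max => /andP[].
Unshelve. all: by end_near. Qed.

End growth.

(** * The three properties of a dimension *)

Lemma inhabited_set_type (T : Type) (A : set T) : A !=set0 -> inhabited A.
Proof. by move=> [x Ax]; exists; exists x; exact: mem_set. Qed.

Lemma asdim_subset (R : realType) (X : metricType R) (A B : set X) :
  A !=set0 -> A `<=` B -> (asdim A <= asdim B)%E.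
Proof.
move=> A0 AB; pose f (a : A) : B := SigSub (mem_set (AB _ (set_mem (valP a)))).
exact: (@asdim_le_isometry _ _ _ f (inhabited_set_type A0)).
Qed.

Local Open Scope ereal_scope.

Theorem theorem3p11 (R : realType) :
  (forall (Y : metricType R) (X : set Y), X !=set0 -> asdim X <= asdim Y) /\
  (forall (X : metricType R) (X1 X2 : set X), X1 !=set0 -> X2 !=set0 ->
     asdim (X1 `|` X2) = maxe (asdim X1) (asdim X2)) /\
  (forall (X Y : metricType R) (d : prod_metric X Y),
     inhabited X -> inhabited Y ->
     asdim (prod_space d) <= asdim X + asdim Y).
Proof.
split=> [Y X X0|].
  exact: (@asdim_le_isometry _ _ _ (fun x : X => val x) (inhabited_set_type X0)).
split=> [X A B A0 B0|X Y d [x] [y]].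
  (* Monotonicity gives one inequality; for the other, the ranges of the two inclusions exhaust the
     union. *)
  apply/eqP; rewrite eq_le ge_max !asdim_subset// ?andbT.
  pose f (a : A) : (A `|` B) := SigSub (mem_set (or_introl (set_mem (valP a)))).
  pose g (b : B) : (A `|` B) := SigSub (mem_set (or_intror (set_mem (valP b)))).
  apply: (@asdim_le_maxe _ _ _ _ f g) => //; try exact: inhabited_set_type.
  case=> z zAB; have [zA|zB] := set_mem zAB; [left|right].
    by exists (SigSub (mem_set zA)) => //; exact: val_inj.
  by exists (SigSub (mem_set zB)) => //; exact: val_inj.
(* The identity from the given metric to the max metric is bi-Lipschitz, which reduces the claim to
   the max metric. *)
have [L L0 dL] := pdist_bilipschitz d.
apply: le_trans (asdim_max_metric_le (inhabits x) (inhabits y)).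
pose f (p : prod_space d) : prod_space (max_metric X Y) := p.
apply: (@asdim_le_embedding _ _ _ f L (inhabits (x, y)) L0) => p q.
rewrite !mdist_prodE /=; have /andP[dl dr] := dL p q; split=> //.
by rewrite -ler_pdivrMl.
Qed.
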